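(* For all integers $m,n\ge 1$, the dimension over $\mathbb K$ of the subspace $\mathfrak D_n^m$ of homogeneous elements of degree $n$ of the free $\mathrm{Dyck}^m$ algebra $\mathfrak D^m$ on one generator is $$\dim_{\mathbb K}\mathfrak D_n^m=d_{m,n}:=\frac{1}{mn+1}\binom{(m+1)n}{n}.$$
   Context: $\mathbb K$ is a field. For $m\ge 0$, a $\mathrm{Dyck}^m$ algebra over $\mathbb K$ is a $\mathbb K$-vector space $D$ with $m+1$ bilinear operations $*_0,\dots,*_m:D\otimes D\to D$ such that for all $x,y,z\in D$: (1) $x*_i(y*_jz)=(x*_iy)*_jz$ for $0\le i<j\le m$; (2) $\sum_{j=0}^i x*_i(y*_jz)=\sum_{k=i}^m (x*_ky)*_iz$ for $0\le i\le m$. $\mathfrak D^m$ is the free $\mathrm{Dyck}^m$ algebra on one generator, graded so that the generator has degree $1$ and every product $*_i$ is additive on degrees (the relations are homogeneous). *)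

(* Defs.v *)
From HB Require Import structures.
From mathcomp Require Import all_boot all_order all_algebra.
From mathcomp Require Import boolp functions.

Set Implicit Arguments.
Unset Strict Implicit.
Unset Printing Implicit Defensive.

Import GRing.Theory.
Local Open Scope ring_scope.

(* A Dyck^m algebra over K; the operation *_i is [dyck_op i], i : 'I_m.+1. *)
HB.mixin Record isDyckAlgebra (K : fieldType) (m : nat) D
    of GRing.Lmodule K D := {
  dyck_op : 'I_m.+1 -> D -> D -> D;
  dyck_op_linearl : forall i z, linear (fun x => dyck_op i x z);
  dyck_op_linearr : forall i x, linear (dyck_op i x);
  dyck_opA : forall (i j : 'I_m.+1) x y z, (i < j)%N ->
    dyck_op i x (dyck_op j y z) = dyck_op j (dyck_op i x y) z;
  dyck_op_sum : forall (i : 'I_m.+1) x y z,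
    \sum_(j < m.+1 | (j <= i)%N) dyck_op i x (dyck_op j y z)
    = \sum_(k < m.+1 | (i <= k)%N) dyck_op i (dyck_op k x y) z
}.

#[short(type="dyckAlgType")]
HB.structure Definition DyckAlgebra (K : fieldType) (m : nat) :=
  {D of isDyckAlgebra K m D & GRing.Lmodule K D}.

Definition dyck_morphism (K : fieldType) (m : nat) (D E : dyckAlgType K m)
    (f : D -> E) : Prop :=
  linear f /\
  (forall (i : 'I_m.+1) u v, f (dyck_op i u v) = dyck_op i (f u) (f v)).

Definition is_free_dyck (K : fieldType) (m : nat) (D : dyckAlgType K m)
    (x : D) : Prop :=
  forall (E : dyckAlgType K m) (y : E), exists f : D -> E,
    [/\ dyck_morphism f, f x = y &
        forall g : D -> E, dyck_morphism g -> g x = y -> g =1 f].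

(* The smallest family of subspaces D_n with x in D_1 and
   D_a *_i D_b included in D_(a + b). When D is free on x it is the grading
   of D: see [homogeneous_generate] and [homogeneous_direct] below. *)
Inductive homogeneous (K : fieldType) (m : nat) (D : dyckAlgType K m) (x : D) :
    nat -> D -> Prop :=
| homogeneous_gen : homogeneous x 1 x
| homogeneous_op a b (i : 'I_m.+1) u v :
    homogeneous x a u -> homogeneous x b v ->
    homogeneous x (a + b) (dyck_op i u v)
| homogeneous_0 n : homogeneous x n 0
| homogeneous_lin n (c : K) u v :
    homogeneous x n u -> homogeneous x n v -> homogeneous x n (c *: u + v).

(* The subspace V of a (possibly infinite-dimensional) vector space has a
   basis of d vectors. *)
Definition has_dim (K : fieldType) (D : lmodType K) (V : D -> Prop) (d : nat) :
    Prop :=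
  exists b : 'I_d -> D,
    (forall c : 'I_d -> K, \sum_i c i *: b i = 0 -> forall i, c i = 0) /\
    (forall v, V v <-> exists c : 'I_d -> K, v = \sum_i c i *: b i).

Definition dyck_number (m n : nat) : rat :=
  'C(m.+1 * n, n)%:R / (m * n).+1%:R.

(* The rest of the file checks that free algebras on one generator exist and
   that [homogeneous] is a grading on them. *)

Inductive dyck_term (K : Type) (m : nat) : Type :=
| TGen
| TZero
| TAdd of dyck_term K m & dyck_term K m
| TScale of K & dyck_term K m
| TOp of 'I_m.+1 & dyck_term K m & dyck_term K m.
Arguments TGen {K m}.
Arguments TZero {K m}.

Definition TSum (K : Type) (m : nat) (s : seq (dyck_term K m)) :
    dyck_term K m := foldr (@TAdd K m) TZero s.

Inductive dyck_cong (K : fieldType) (m : nat) :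
    dyck_term K m -> dyck_term K m -> Prop :=
| CRefl s : dyck_cong s s
| CSym s t : dyck_cong s t -> dyck_cong t s
| CTrans s t u : dyck_cong s t -> dyck_cong t u -> dyck_cong s u
| CAdd s s' t t' :
    dyck_cong s s' -> dyck_cong t t' -> dyck_cong (TAdd s t) (TAdd s' t')
| CScale c s s' : dyck_cong s s' -> dyck_cong (TScale c s) (TScale c s')
| COp i s s' t t' :
    dyck_cong s s' -> dyck_cong t t' -> dyck_cong (TOp i s t) (TOp i s' t')
| CAddA s t u : dyck_cong (TAdd s (TAdd t u)) (TAdd (TAdd s t) u)
| CAddC s t : dyck_cong (TAdd s t) (TAdd t s)
| CAdd0 s : dyck_cong (TAdd TZero s) s
| CAddN s : dyck_cong (TAdd (TScale (-1) s) s) TZero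
| CScaleA a b s : dyck_cong (TScale a (TScale b s)) (TScale (a * b) s)
| CScale1 s : dyck_cong (TScale 1 s) s
| CScaleDr a s t :
    dyck_cong (TScale a (TAdd s t)) (TAdd (TScale a s) (TScale a t))
| CScaleDl a b s :
    dyck_cong (TScale (a + b) s) (TAdd (TScale a s) (TScale b s))
| COpl i a s t u :
    dyck_cong (TOp i (TAdd (TScale a s) t) u)
              (TAdd (TScale a (TOp i s u)) (TOp i t u))
| COpr i a s t u :
    dyck_cong (TOp i u (TAdd (TScale a s) t))
              (TAdd (TScale a (TOp i u s)) (TOp i u t))
| COpA (i j : 'I_m.+1) s t u : (i < j)%N ->
    dyck_cong (TOp i s (TOp j t u)) (TOp j (TOp i s t) u)
| COpS (i : 'I_m.+1) s t u :
    dyck_cong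
      (TSum [seq TOp i s (TOp j t u) | j : 'I_m.+1 <- enum 'I_m.+1
             & (j <= i)%N])
      (TSum [seq TOp i (TOp k s t) u | k : 'I_m.+1 <- enum 'I_m.+1
             & (i <= k)%N]).

Definition dyck_congb (K : fieldType) (m : nat)
    (s t : {classic dyck_term K m}) : bool := `[< dyck_cong s t >].

Lemma dyck_congb_refl (K : fieldType) (m : nat) : reflexive (@dyck_congb K m).
Proof. by move=> s; apply/asboolP; constructor. Qed.

Lemma dyck_congb_sym (K : fieldType) (m : nat) : symmetric (@dyck_congb K m).
Proof. by move=> s t; apply/asboolP/asboolP; apply: CSym. Qed.

Lemma dyck_congb_trans (K : fieldType) (m : nat) :
  transitive (@dyck_congb K m).
Proof.
by move=> t s u /asboolP h1 /asboolP h2; apply/asboolP; apply: CTrans h1 h2.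
Qed.

Local Open Scope quotient_scope.

Definition dyck_equiv (K : fieldType) (m : nat) :=
  EquivRel (@dyck_congb K m) (@dyck_congb_refl K m) (@dyck_congb_sym K m)
           (@dyck_congb_trans K m).

Definition free_dyck (K : fieldType) (m : nat) : Type :=
  {eq_quot (dyck_equiv K m)}.

HB.instance Definition _ (K : fieldType) (m : nat) :=
  EqQuotient.on (free_dyck K m).
HB.instance Definition _ (K : fieldType) (m : nat) :=
  Choice.on (free_dyck K m).

Definition fpi (K : fieldType) (m : nat) (s : dyck_term K m) : free_dyck K m :=
  \pi_{eq_quot (dyck_equiv K m)} (s : {classic dyck_term K m}).

Definition frepr (K : fieldType) (m : nat) (v : free_dyck K m) :
    dyck_term K m :=
  repr (v : {eq_quot (dyck_equiv K m)}).

Lemma fpiP (K : fieldType) (m : nat) (s t : dyck_term K m) :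
  fpi s = fpi t <-> dyck_cong s t.
Proof.
split=> [h|h]; first exact/asboolP/(@eqmodP _ (dyck_equiv K m)).
by apply/(@eqmodP _ (dyck_equiv K m))/asboolP.
Qed.

Lemma freprK (K : fieldType) (m : nat) (v : free_dyck K m) : fpi (frepr v) = v.
Proof. exact: reprK. Qed.

Lemma cong_frepr (K : fieldType) (m : nat) (s : dyck_term K m) :
  dyck_cong (frepr (fpi s)) s.
Proof. by apply/fpiP; rewrite freprK. Qed.

Definition fadd (K : fieldType) (m : nat) (u v : free_dyck K m) :=
  fpi (TAdd (frepr u) (frepr v)).
Definition fscale (K : fieldType) (m : nat) (c : K) (u : free_dyck K m) :=
  fpi (TScale c (frepr u)).
Definition fop (K : fieldType) (m : nat) (i : 'I_m.+1) (u v : free_dyck K m) :=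
  fpi (TOp i (frepr u) (frepr v)).

Lemma fpi_add (K : fieldType) (m : nat) (s t : dyck_term K m) :
  fadd (fpi s) (fpi t) = fpi (TAdd s t).
Proof. by apply/fpiP; apply: CAdd; apply: cong_frepr. Qed.
Lemma fpi_scale (K : fieldType) (m : nat) c (s : dyck_term K m) :
  fscale c (fpi s) = fpi (TScale c s).
Proof. by apply/fpiP; apply: CScale; apply: cong_frepr. Qed.
Lemma fpi_op (K : fieldType) (m : nat) i (s t : dyck_term K m) :
  fop i (fpi s) (fpi t) = fpi (TOp i s t).
Proof. by apply/fpiP; apply: COp; apply: cong_frepr. Qed.

Lemma faddA (K : fieldType) (m : nat) : associative (@fadd K m).
Proof.
move=> u v w; rewrite -(freprK u) -(freprK v) -(freprK w) !fpi_add.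
by apply/fpiP; apply: CAddA.
Qed.
Lemma faddC (K : fieldType) (m : nat) : commutative (@fadd K m).
Proof.
by move=> u v; rewrite -(freprK u) -(freprK v) !fpi_add; apply/fpiP/CAddC.
Qed.
Lemma fadd0 (K : fieldType) (m : nat) : left_id (fpi TZero) (@fadd K m).
Proof. by move=> u; rewrite -(freprK u) fpi_add; apply/fpiP/CAdd0. Qed.
Lemma faddN (K : fieldType) (m : nat) :
  left_inverse (fpi TZero) (fscale (-1)) (@fadd K m).
Proof.
by move=> u; rewrite -(freprK u) fpi_scale fpi_add; apply/fpiP/CAddN.
Qed.

HB.instance Definition _ (K : fieldType) (m : nat) :=
  GRing.isZmodule.Build (free_dyck K m) (@faddA K m) (@faddC K m) (@fadd0 K m)
    (@faddN K m).

Lemma fpiD (K : fieldType) (m : nat) (s t : dyck_term K m) :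
  fpi (TAdd s t) = fpi s + fpi t.
Proof. by rewrite -fpi_add. Qed.

Lemma fscaleA (K : fieldType) (m : nat) a b (v : free_dyck K m) :
  fscale a (fscale b v) = fscale (a * b) v.
Proof. by rewrite -(freprK v) !fpi_scale; apply/fpiP/CScaleA. Qed.
Lemma fscale1 (K : fieldType) (m : nat) : left_id 1 (@fscale K m).
Proof. by move=> v; rewrite -(freprK v) fpi_scale; apply/fpiP/CScale1. Qed.
Lemma fscaleDr (K : fieldType) (m : nat) :
  right_distributive (@fscale K m) +%R.
Proof.
move=> a u v; rewrite -(freprK u) -(freprK v).
by rewrite -fpiD !fpi_scale -fpiD; apply/fpiP/CScaleDr.
Qed.
Lemma fscaleDl (K : fieldType) (m : nat) (v : free_dyck K m) :
  {morph (fun a => fscale a v) : a b / a + b}.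
Proof.
move=> a b; rewrite -(freprK v) !fpi_scale -fpiD.
exact/fpiP/CScaleDl.
Qed.

HB.instance Definition _ (K : fieldType) (m : nat) :=
  GRing.Zmodule_isLmodule.Build K (free_dyck K m) (@fscaleA K m) (@fscale1 K m)
    (@fscaleDr K m) (@fscaleDl K m).

Lemma fpiZ (K : fieldType) (m : nat) a (s : dyck_term K m) :
  fpi (TScale a s) = a *: fpi s.
Proof. by rewrite -fpi_scale. Qed.
Lemma fpi_sum (K : fieldType) (m : nat) (s : seq (dyck_term K m)) :
  fpi (TSum s) = \sum_(t <- s) fpi t.
Proof.
by elim: s => [|t s IH]; rewrite ?big_nil // big_cons /= fpiD IH.
Qed.

Lemma fop_linearl (K : fieldType) (m : nat) (i : 'I_m.+1)
  (z : free_dyck K m) : linear (fun x => fop i x z).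
Proof.
move=> a u v; rewrite -(freprK u) -(freprK v) -(freprK z).
by rewrite -fpiZ -fpiD !fpi_op -fpiZ -fpiD; apply/fpiP/COpl.
Qed.
Lemma fop_linearr (K : fieldType) (m : nat) (i : 'I_m.+1)
  (x : free_dyck K m) : linear (fop i x).
Proof.
move=> a u v; rewrite -(freprK u) -(freprK v) -(freprK x).
by rewrite -fpiZ -fpiD !fpi_op -fpiZ -fpiD; apply/fpiP/COpr.
Qed.
Lemma fopA (K : fieldType) (m : nat) (i j : 'I_m.+1) (x y z : free_dyck K m) :
  (i < j)%N -> fop i x (fop j y z) = fop j (fop i x y) z.
Proof.
move=> ij; rewrite -(freprK x) -(freprK y) -(freprK z) !fpi_op.
exact/fpiP/COpA.
Qed.
Lemma fop_sum (K : fieldType) (m : nat) (i : 'I_m.+1) (x y z : free_dyck K m) :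
  \sum_(j < m.+1 | (j <= i)%N) fop i x (fop j y z)
  = \sum_(k < m.+1 | (i <= k)%N) fop i (fop k x y) z.
Proof.
rewrite -(freprK x) -(freprK y) -(freprK z).
have /fpiP := COpS i (frepr x) (frepr y) (frepr z).
rewrite !fpi_sum !big_map !big_filter !big_enum_cond /= => h.
have e (P : pred 'I_m.+1) (F G : 'I_m.+1 -> free_dyck K m) :
    F =1 G -> \sum_(j | P j) F j = \sum_(j | P j) G j.
  by move=> FG; apply: eq_bigr.
rewrite (e _ _ (fun j => fpi (TOp i (frepr x) (TOp j (frepr y) (frepr z)))));
  last by move=> j; rewrite !fpi_op.
rewrite h; apply: e => k; by rewrite !fpi_op.
Qed.

HB.instance Definition _ (K : fieldType) (m : nat) :=
  isDyckAlgebra.Build K m (free_dyck K m) (@fop_linearl K m) (@fop_linearr K m)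
    (@fopA K m) (@fop_sum K m).

Fixpoint dyck_eval (K : fieldType) (m : nat) (E : dyckAlgType K m) (y : E)
    (s : dyck_term K m) : E :=
  match s with
  | TGen => y
  | TZero => 0
  | TAdd s t => dyck_eval y s + dyck_eval y t
  | TScale c s => c *: dyck_eval y s
  | TOp i s t => dyck_op i (dyck_eval y s) (dyck_eval y t)
  end.

Lemma dyck_eval_sum (K : fieldType) (m : nat) (E : dyckAlgType K m) (y : E)
    (s : seq (dyck_term K m)) :
  dyck_eval y (TSum s) = \sum_(t <- s) dyck_eval y t.
Proof. by elim: s => [|t s IH] /=; rewrite ?big_nil // big_cons IH. Qed.

Lemma dyck_eval_cong (K : fieldType) (m : nat) (E : dyckAlgType K m) (y : E)
    (s t : dyck_term K m) :
  dyck_cong s t -> dyck_eval y s = dyck_eval y t.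
Proof.
elim=> //=; try by move=> *; congruence.
- by move=> *; rewrite addrA.
- by move=> *; rewrite addrC.
- by move=> *; rewrite add0r.
- by move=> *; rewrite scaleN1r addNr.
- by move=> *; rewrite scalerA.
- by move=> *; rewrite scale1r.
- by move=> *; rewrite scalerDr.
- by move=> *; rewrite scalerDl.
- by move=> i a {}s {}t u; rewrite dyck_op_linearl.
- by move=> i a {}s {}t u; rewrite dyck_op_linearr.
- by move=> i j {}s {}t u ij; rewrite dyck_opA.
- move=> i {}s {}t u; rewrite !dyck_eval_sum !big_map !big_filter.
  by rewrite !big_enum_cond /= dyck_op_sum.
Qed.

Definition free_dyck_gen (K : fieldType) (m : nat) : free_dyck K m := fpi TGen.

Lemma dyck_morphismP (K : fieldType) (m : nat) (E : dyckAlgType K m)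
    (f : free_dyck K m -> E) (s : dyck_term K m) : dyck_morphism f ->
  f (fpi s) = dyck_eval (f (free_dyck_gen K m)) s.
Proof.
move=> [fl fm].
have f0 : f 0 = 0 by have := fl (-1) 0 0; rewrite scaler0 addr0 scaleN1r addNr.
elim: s => [//|//|s IHs t IHt|c s IHs|i s IHs t IHt] /=.
- by rewrite fpiD -[fpi s]scale1r fl scale1r IHs IHt.
- by rewrite fpiZ -[_ *: _]addr0 fl f0 addr0 IHs.
- by rewrite -fpi_op fm IHs IHt.
Qed.

Theorem free_dyck_free (K : fieldType) (m : nat) :
  is_free_dyck (free_dyck_gen K m).
Proof.
move=> E y; pose f (v : free_dyck K m) := dyck_eval y (frepr v).
have fE s : f (fpi s) = dyck_eval y s by apply/dyck_eval_cong/cong_frepr.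
exists f; split; [split| exact: fE |].
- move=> c u v; rewrite -(freprK u) -(freprK v) -fpiZ -fpiD !fE //.
- move=> i u v; rewrite -(freprK u) -(freprK v) [dyck_op i _ _]fpi_op !fE //.
- by move=> g gm gx v; rewrite -(freprK v) (dyck_morphismP _ gm) gx fE.
Qed.

Lemma is_free_dyck_ind (K : fieldType) (m : nat) (D : dyckAlgType K m) (x : D)
    (P : D -> Prop) : is_free_dyck x ->
  P x -> P 0 -> (forall c u v, P u -> P v -> P (c *: u + v)) ->
  (forall i u v, P u -> P v -> P (dyck_op i u v)) -> forall v, P v.
Proof.
move=> xfree Px P0 Pl Po v.
have [f [[fl fm] fx _]] := xfree (free_dyck K m) (free_dyck_gen K m).
have [g [gm gx _]] := free_dyck_free x.
have [h [_ _ hu]] := xfree D x.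
have <- : g (f v) = v.
  have gfm : dyck_morphism (fun w => g (f w)).
    by case: gm => gl gm; split=> [c a b|i a b]; rewrite ?fl ?fm ?gl ?gm.
  have idm : dyck_morphism (fun w : D => w) by [].
  by rewrite (hu _ gfm) ?fx // -(hu _ idm).
rewrite -(freprK (f v)) (dyck_morphismP _ gm) gx.
elim: (frepr _) => //= [s IHs t IHt|c s IHs|i s IHs t IHt].
- by rewrite -[dyck_eval x s]scale1r; apply: Pl.
- by rewrite -[_ *: _]addr0; apply: Pl.
- exact: Po.
Qed.

Lemma dyck_op0l (K : fieldType) (m : nat) (D : dyckAlgType K m) i (z : D) :
  dyck_op i 0 z = 0.
Proof.
have := dyck_op_linearl i z (-1) 0 0.
by rewrite scaler0 addr0 scaleN1r addNr.
Qed.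
Lemma dyck_op0r (K : fieldType) (m : nat) (D : dyckAlgType K m) i (z : D) :
  dyck_op i z 0 = 0.
Proof.
have := dyck_op_linearr i z (-1) 0 0.
by rewrite scaler0 addr0 scaleN1r addNr.
Qed.
Lemma dyck_opDl (K : fieldType) (m : nat) (D : dyckAlgType K m) i (u v z : D) :
  dyck_op i (u + v) z = dyck_op i u z + dyck_op i v z.
Proof. by have := dyck_op_linearl i z 1 u v; rewrite !scale1r. Qed.
Lemma dyck_opDr (K : fieldType) (m : nat) (D : dyckAlgType K m) i (u v z : D) :
  dyck_op i z (u + v) = dyck_op i z u + dyck_op i z v.
Proof. by have := dyck_op_linearr i z 1 u v; rewrite !scale1r. Qed.
Lemma dyck_op_suml (K : fieldType) (m : nat) (D : dyckAlgType K m) i (z : D)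
    (I : Type) (r : seq I) (P : pred I) (F : I -> D) :
  dyck_op i (\sum_(a <- r | P a) F a) z = \sum_(a <- r | P a) dyck_op i (F a) z.
Proof.
exact: (big_morph (fun w => dyck_op i w z) (fun u v => dyck_opDl i u v z)
  (dyck_op0l i z)).
Qed.
Lemma dyck_op_sumr (K : fieldType) (m : nat) (D : dyckAlgType K m) i (z : D)
    (I : Type) (r : seq I) (P : pred I) (F : I -> D) :
  dyck_op i z (\sum_(a <- r | P a) F a) = \sum_(a <- r | P a) dyck_op i z (F a).
Proof.
exact: (big_morph (dyck_op i z) (fun u v => dyck_opDr i u v z) (dyck_op0r i z)).
Qed.

Lemma homogeneous_add (K : fieldType) (m : nat) (D : dyckAlgType K m)
    (x u v : D) n :
  homogeneous x n u -> homogeneous x n v -> homogeneous x n (u + v).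
Proof. by move=> hu hv; rewrite -[u]scale1r; apply: homogeneous_lin. Qed.

Lemma homogeneous_sum (K : fieldType) (m : nat) (D : dyckAlgType K m)
    (x : D) n (I : Type) (r : seq I) (P : pred I) (F : I -> D) :
  (forall i, P i -> homogeneous x n (F i)) ->
  homogeneous x n (\sum_(i <- r | P i) F i).
Proof.
move=> hF; apply: big_ind => //; first exact: homogeneous_0.
by move=> u v; apply: homogeneous_add.
Qed.

Lemma homogeneous_generate (K : fieldType) (m : nat) (D : dyckAlgType K m)
    (x : D) : is_free_dyck x ->
  forall v, exists N (w : nat -> D),
    (forall n, homogeneous x n (w n)) /\ v = \sum_(0 <= n < N) w n.
Proof.
move=> xfree.
pose P v := exists N (w : nat -> D),
  (forall n, homogeneous x n (w n)) /\ v = \sum_(0 <= n < N) w n.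
have P0 : P 0.
  by exists 0, (fun=> 0); rewrite big_nil; split=> // n; apply: homogeneous_0.
have Pn n u : homogeneous x n u -> P u.
  move=> hu; exists n.+1, (fun k => if k == n then u else 0); split.
    by move=> k; case: eqP => [->//|_]; apply: homogeneous_0.
  rewrite big_nat_recr //= eqxx big_nat big1 ?add0r // => k /andP[_ kn].
  by rewrite ltn_eqF.
have Pl c u v : P u -> P v -> P (c *: u + v).
  move=> [N1 [w1 [h1 ->]]] [N2 [w2 [h2 ->]]].
  pose t (b : bool) (u : D) := if b then u else 0.
  have ht k b u' : homogeneous x k u' -> homogeneous x k (t b u').
    by case: b => //= _; apply: homogeneous_0.
  have tE N M (w : nat -> D) : (N <= M)%N ->
      \sum_(0 <= n < M) t (n < N)%N (w n) = \sum_(0 <= n < N) w n.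
    by move=> NM; rewrite -big_mkcond [RHS](big_nat_widen _ _ M).
  exists (maxn N1 N2),
    (fun k => c *: t (k < N1)%N (w1 k) + t (k < N2)%N (w2 k)).
  split; first by move=> k; apply: homogeneous_lin; apply: ht.
  by rewrite big_split /= -scaler_sumr !tE ?leq_maxl ?leq_maxr.
have PD u v : P u -> P v -> P (u + v).
  by move=> hu hv; rewrite -[u]scale1r; apply: Pl.
apply: (is_free_dyck_ind xfree) => //;
  first exact: Pn (@homogeneous_gen _ _ _ x).
move=> i _ _ [N1 [w1 [h1 ->]]] [N2 [w2 [h2 ->]]].
rewrite dyck_op_suml; apply: (big_ind P) => // a _.
rewrite dyck_op_sumr; apply: (big_ind P) => // b _.
by apply: (Pn (a + b)%N); apply: homogeneous_op.
Qed.

(* Sequences of elements of D, with the Cauchy products of the *_i. *)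
Definition dyck_seq (D : Type) : Type := nat -> D.

HB.instance Definition _ (K : fieldType) (D : lmodType K) :=
  GRing.Lmodule.on (dyck_seq D).

Definition dyck_seq_op (K : fieldType) (m : nat) (D : dyckAlgType K m)
    (i : 'I_m.+1) (f g : dyck_seq D) : dyck_seq D :=
  fun n => \sum_(0 <= a < n.+1) dyck_op i (f a) (g (n - a)%N).

Lemma exchange_triangle (V : nmodType) (F : nat -> nat -> nat -> V) n :
  \sum_(0 <= a < n.+1) \sum_(0 <= b < (n - a).+1) F a b (n - a - b)%N
  = \sum_(0 <= c < n.+1) \sum_(0 <= a < c.+1) F a (c - a)%N (n - c)%N.
Proof.
transitivity (\sum_(0 <= a < n.+1) \sum_(0 <= c < n.+1 | (a <= c)%N)
    F a (c - a)%N (n - c)%N).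
  apply: eq_big_nat => a /andP[_ an]; rewrite -subSn //.
  rewrite -(big_nat_widenl a 0 n.+1 xpredT) //.
  have -> (G : nat -> V) : \sum_(a <= c < n.+1) G c =
      \sum_(0 <= b < n.+1 - a) G (b + a)%N.
    by rewrite -{1}[a]add0n big_addn.
  apply: eq_big_nat => b _.
  by rewrite addnK addnC subnDA.
rewrite (exchange_big_dep_nat xpredT) //=; apply: eq_big_nat => c /andP[_ cn].
by rewrite [RHS](big_nat_widen _ _ n.+1).
Qed.

Lemma dyck_seq_op_linearl (K : fieldType) (m : nat) (D : dyckAlgType K m)
    (i : 'I_m.+1) (z : dyck_seq D) : linear (fun x => dyck_seq_op i x z).
Proof.
move=> c f g; apply/funext => n; rewrite /dyck_seq_op.
transitivity (c *: (\sum_(0 <= a < n.+1) dyck_op i (f a) (z (n - a)%N))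
  + \sum_(0 <= a < n.+1) dyck_op i (g a) (z (n - a)%N)) => //.
rewrite scaler_sumr -big_split /=; apply: eq_bigr => a _.
exact: dyck_op_linearl.
Qed.

Lemma dyck_seq_op_linearr (K : fieldType) (m : nat) (D : dyckAlgType K m)
    (i : 'I_m.+1) (x : dyck_seq D) : linear (dyck_seq_op i x).
Proof.
move=> c f g; apply/funext => n; rewrite /dyck_seq_op.
transitivity (c *: (\sum_(0 <= a < n.+1) dyck_op i (x a) (f (n - a)%N))
  + \sum_(0 <= a < n.+1) dyck_op i (x a) (g (n - a)%N)) => //.
rewrite scaler_sumr -big_split /=; apply: eq_bigr => a _.
exact: dyck_op_linearr.
Qed.

Lemma dyck_seq_opr (K : fieldType) (m : nat) (D : dyckAlgType K m)
    (i j : 'I_m.+1) (x y z : dyck_seq D) n :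
  dyck_seq_op i x (dyck_seq_op j y z) n
  = \sum_(0 <= c < n.+1) \sum_(0 <= a < c.+1)
      dyck_op i (x a) (dyck_op j (y (c - a)%N) (z (n - c)%N)).
Proof.
rewrite -(exchange_triangle
  (fun a b c => dyck_op i (x a) (dyck_op j (y b) (z c)))).
by apply: eq_bigr => a _; rewrite dyck_op_sumr.
Qed.

Lemma dyck_seq_opl (K : fieldType) (m : nat) (D : dyckAlgType K m)
    (i j : 'I_m.+1) (x y z : dyck_seq D) n :
  dyck_seq_op i (dyck_seq_op j x y) z n
  = \sum_(0 <= c < n.+1) \sum_(0 <= a < c.+1)
      dyck_op i (dyck_op j (x a) (y (c - a)%N)) (z (n - c)%N).
Proof. by apply: eq_bigr => c _; rewrite dyck_op_suml. Qed.

Lemma dyck_seq_opA (K : fieldType) (m : nat) (D : dyckAlgType K m)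
    (i j : 'I_m.+1) (x y z : dyck_seq D) : (i < j)%N ->
  dyck_seq_op i x (dyck_seq_op j y z) = dyck_seq_op j (dyck_seq_op i x y) z.
Proof.
move=> ij; apply/funext => n; rewrite dyck_seq_opr dyck_seq_opl.
by apply: eq_bigr => c _; apply: eq_bigr => a _; apply: dyck_opA.
Qed.

Lemma dyck_seq_op_sum (K : fieldType) (m : nat) (D : dyckAlgType K m)
    (i : 'I_m.+1) (x y z : dyck_seq D) :
  \sum_(j < m.+1 | (j <= i)%N) dyck_seq_op i x (dyck_seq_op j y z)
  = \sum_(k < m.+1 | (i <= k)%N) dyck_seq_op i (dyck_seq_op k x y) z.
Proof.
apply/funext => n; rewrite !fct_sumE.
under eq_bigr do rewrite dyck_seq_opr.
under [RHS]eq_bigr do rewrite dyck_seq_opl.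
rewrite exchange_big [RHS]exchange_big; apply: eq_bigr => c _ /=.
rewrite exchange_big [RHS]exchange_big; apply: eq_bigr => a _ /=.
exact: dyck_op_sum.
Qed.

HB.instance Definition _ (K : fieldType) (m : nat) (D : dyckAlgType K m) :=
  isDyckAlgebra.Build K m (dyck_seq D) (@dyck_seq_op_linearl K m D)
    (@dyck_seq_op_linearr K m D) (@dyck_seq_opA K m D) (@dyck_seq_op_sum K m D).

Lemma homogeneous_direct (K : fieldType) (m : nat) (D : dyckAlgType K m)
    (x : D) : is_free_dyck x ->
  forall N (w : nat -> D), (forall n, homogeneous x n (w n)) ->
    \sum_(0 <= n < N) w n = 0 -> forall n, (n < N)%N -> w n = 0.
Proof.
move=> xfree N w hw w0 n nN.
pose d k (u : D) : dyck_seq D := fun l => if l == k then u else 0.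
have [f [[fl fm] fx _]] := xfree (dyck_seq D) (d 1%N x).
have f0 : f 0 = 0 by have := fl (-1) 0 0; rewrite scaler0 addr0 scaleN1r addNr.
have fD u v : f (u + v) = f u + f v.
  by have := fl 1 u v; rewrite !scale1r.
have fd k u : homogeneous x k u -> f u = d k u.
  elim=> {k u} [|a b i u v _ IHu _ IHv|k|k c u v _ IHu _ IHv] //.
  - rewrite fm IHu IHv; apply/funext => l.
    rewrite [LHS](_ : _ = \sum_(0 <= a' < l.+1)
      dyck_op i (d a u a') (d b v (l - a')%N)) // /d.
    case: eqP => [->|/eqP lab].
      rewrite (bigD1_seq a) ?iota_uniq ?mem_index_iota ?ltnS ?leq_addr //=.
      rewrite eqxx addKn eqxx big1 ?addr0 // => a' /negPf ->.
      exact: dyck_op0l.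
    rewrite big_nat big1 // => a' /andP[_ al].
    case: eqP => [ea|_]; last exact: dyck_op0l.
    case: eqP => [eb|_]; last exact: dyck_op0r.
    by rewrite -ea -eb subnKC // eqxx in lab.
  - by rewrite f0; apply/funext => l; rewrite /d; case: eqP.
  - rewrite fl IHu IHv; apply/funext => l.
    rewrite [LHS](_ : _ = c *: d k u l + d k v l) // /d.
    by case: eqP => _ //; rewrite scaler0 addr0.
have := congr1 (fun s => f s n) w0.
rewrite f0 (big_morph f fD f0) /=.
under eq_bigr => k _ do rewrite (fd _ _ (hw k)).
rewrite fct_sumE (bigD1_seq n) ?iota_uniq ?mem_index_iota //= /d eqxx.
by rewrite big1 ?addr0 // => k /negPf kn; rewrite eq_sym kn.
Qed.

(* Main.v *)
Require Import Defs.
From HB Require Import structures.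
From mathcomp Require Import all_boot all_order all_algebra.
From mathcomp Require Import boolp freeg.
From mathcomp Require Import ring zify.

Set Implicit Arguments.
Unset Strict Implicit.
Unset Printing Implicit Defensive.

Import GRing.Theory.
Local Open Scope ring_scope.

(** The relations, read as rewriting rules
      x *_i (y *_j z) --> (x *_i y) *_j z                       for i < j,
      x *_i (y *_i z) --> sum_(k >= i) (x *_k y) *_i z
                          - sum_(l < i) x *_i (y *_l z),
    either shift parentheses to the left or lower the label of a right factor.
    The irreducible monomials are the binary trees with nodes labelled by the
    operations in which the root of every right subtree has a smaller label
    than its parent; call them normal.  The theorem says that normal trees with
    n leaves form a basis of degree n, and counts them.

    Existence of a model.  On the vector space spanned by all labelled trees the
    rules define the products: a *_i b is computed by recursion on b, since the
    right-hand sides only involve products whose right factor is a proper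
    subtree of b.  The Dyck relations then hold for all right factors, by
    induction on the tree (dyck_at_tree); this is the confluence of the rules.
    The inductive step needs the relations at both subtrees, and for equal
    labels it reduces to two summed identities (sum_dyck_ge, sum_dyck_lt).  In
    this algebra a normal tree is the product of its two subtrees, so evaluating
    it at the one-leaf tree returns the tree itself.

    Basis.  By freeness there is a morphism from D to this model that sends the
    generator to the one-leaf tree, hence the normal trees evaluated in D are
    linearly independent (tree_eval_section).  Conversely the evaluation of
    trees in D is multiplicative, because the defining rules are consequences
    of the relations of D, and products of normal trees are combinations of
    normal trees with the right number of leaves (supported_tree_op); hence
    evaluated normal trees span (homogeneous_eval).

    Counting.  Let c(n, q) be the number of normal trees with n leaves whose
    root label is less than q.  Splitting off the trees with root label q gives
    c(n, q+1) = c(n, q) + sum_k c(k, m+1) c(n-k, q), that is, the generating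
    series of the c(-, q) is t (1 + T)^q with T = t (1 + T)^(m+1).  The
    coefficients of (1 + T)^r are the Raney numbers, which have a closed form
    (raney_closed) and are multiplicative in r (raney_conv). *)

(** * Linear maps on free modules *)

Section LinearMaps.
Context (K : fieldType) (U V W : lmodType K).

Lemma linear_map0 (f : V -> W) : linear f -> f 0 = 0.
Proof.
by move=> fl; have := fl (-1) 0 0; rewrite scaler0 addr0 scaleN1r addNr.
Qed.

Lemma linear_mapD (f : V -> W) : linear f -> {morph f : u v / u + v}.
Proof. by move=> fl u v; have := fl 1 u v; rewrite !scale1r. Qed.

Lemma linear_mapZ (f : V -> W) c v : linear f -> f (c *: v) = c *: f v.
Proof. by move=> fl; have := fl c v 0; rewrite linear_map0 // !addr0. Qed.

Lemma linear_mapB (f : V -> W) : linear f -> {morph f : u v / u - v}.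
Proof.
by move=> fl u v; rewrite addrC -scaleN1r fl scaleN1r addrC.
Qed.

Lemma linear_map_sum (f : V -> W) I (r : seq I) (P : pred I) F :
  linear f -> f (\sum_(i <- r | P i) F i) = \sum_(i <- r | P i) f (F i).
Proof.
by move=> fl; apply: (big_morph f (linear_mapD fl) (linear_map0 fl)).
Qed.

Lemma comp_linear (f : V -> W) (g : U -> V) :
  linear f -> linear g -> linear (fun u => f (g u)).
Proof. by move=> fl gl c u v; rewrite gl fl. Qed.

Lemma sub_linear (f g : V -> W) :
  linear f -> linear g -> linear (fun v => f v - g v).
Proof. by move=> fl gl c u v; rewrite gl fl scalerBr opprD addrACA. Qed.

Lemma sum_linear I (r : seq I) (P : pred I) (F : I -> V -> W) :
  (forall i, linear (F i)) -> linear (fun v => \sum_(i <- r | P i) F i v).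
Proof.
move=> Fl c u v; rewrite scaler_sumr -big_split.
by apply: eq_bigr => i _; apply: Fl.
Qed.

End LinearMaps.

Lemma sum_le_lt (W : nmodType) d (i : 'I_d) (F : 'I_d -> W) :
  \sum_(j < d | (j <= i)%N) F j = F i + \sum_(j < d | (j < i)%N) F j.
Proof.
rewrite (bigD1 i) //=; congr (_ + _); apply: eq_bigl => j.
by rewrite andbC ltn_neqAle.
Qed.

Lemma sum_lt_ge (W : nmodType) d (i : 'I_d) (F : 'I_d -> W) :
  \sum_(j < d) F j
  = \sum_(j < d | (j < i)%N) F j + \sum_(j < d | (i <= j)%N) F j.
Proof.
rewrite (bigID (fun j : 'I_d => (j < i)%N)) /=; congr (_ + _).
by apply: eq_bigl => j; rewrite -leqNgt.
Qed.

Section FreeModule.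
Context (K : fieldType) (T : choiceType).
Implicit Types (W : lmodType K) (u v : {freeg T / K}).

Lemma freegUZ (c : K) (t : T) : << c *g t >> = c *: << t >> :> {freeg T / K}.
Proof. by apply/eqP/freeg_eqP => s; rewrite coeffZ !coeffU mul1r. Qed.

Lemma fglift_linear W (f : T -> W) : linear (fglift f : {freeg T / K} -> W).
Proof.
have fB := lift_is_additive f.
have f0 : fglift f (0 : {freeg T / K}) = 0 by rewrite -{1}(subrr 0) fB subrr.
have fD u v : fglift f (u + v) = fglift f u + fglift f v.
  have fN w : fglift f (- w) = - fglift f w by rewrite -sub0r fB f0 sub0r.
  by rewrite -{1}[v]opprK fB fN opprK.
move=> c u v; rewrite fD; congr (_ + _).
have -> : c *: u = \sum_(t <- dom u) << c * coeff t u *g t >> by [].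
rewrite -[in RHS](freeg_sumE u) !(big_morph (fglift f) fD f0) scaler_sumr.
by apply: eq_bigr => t _; rewrite !liftU scalerA.
Qed.

Lemma fgliftU1 W (f : T -> W) t : fglift f (<< t >> : {freeg T / K}) = f t.
Proof. by rewrite liftU scale1r. Qed.

Lemma freeg_linear_ext W (f g : {freeg T / K} -> W) :
  linear f -> linear g -> (forall t, f << t >> = g << t >>) -> f =1 g.
Proof.
move=> fl gl fg u; rewrite -(freeg_sumE u) !linear_map_sum //.
by apply: eq_bigr => t _; rewrite freegUZ !linear_mapZ // fg.
Qed.

Definition bilinear_ext W (f : T -> T -> W) (u v : {freeg T / K}) : W :=
  fglift (fun a => fglift (f a) v) u.

Lemma bilinear_extl W (f : T -> T -> W) v : linear (bilinear_ext f ^~ v).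
Proof. exact: fglift_linear. Qed.

Lemma bilinear_extr W (f : T -> T -> W) u : linear (bilinear_ext f u).
Proof.
have fE v : bilinear_ext f u v = 
    \sum_(t <- dom u) coeff t u *: fglift (f t) v.
  rewrite /bilinear_ext -{1}(freeg_sumE u) linear_map_sum;
    last exact: fglift_linear.
  by apply: eq_bigr => t _; rewrite liftU.
move=> c v w; rewrite !fE.
apply: (@sum_linear K {freeg T / K} W T (dom u) xpredT
  (fun t v => coeff t u *: fglift (f t) v)) => t.
move=> {c v w} c v w.
by rewrite (fglift_linear (f t) c v w) scalerDr !scalerA mulrC.
Qed.

Lemma bilinear_extU W (f : T -> T -> W) a b :
  bilinear_ext f << a >> << b >> = f a b.
Proof. by rewrite /bilinear_ext !fgliftU1. Qed.

(** Membership in the linear span of the basis vectors selected by S. *)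
Definition supported (S : T -> bool) u := forall t, coeff t u != 0 -> S t.

Lemma supported0 S : supported S 0.
Proof. by move=> t; rewrite coeff0 eqxx. Qed.

Lemma supportedU (S : T -> bool) t : S t -> supported S << t >>.
Proof.
move=> St s; rewrite coeffU mul1r; have [<- //|_] := eqVneq t s.
by rewrite eqxx.
Qed.

Lemma supported_lin (S : T -> bool) c u v :
  supported S u -> supported S v -> supported S (c *: u + v).
Proof.
move=> Su Sv t; rewrite coeffD coeffZ.
have [u0|un0 _] := eqVneq (coeff t u) 0; last exact: Su.
by rewrite u0 mulr0 add0r; apply: Sv.
Qed.

Lemma supportedD (S : T -> bool) u v :
  supported S u -> supported S v -> supported S (u + v).
Proof. by move=> Su Sv; rewrite -[u]scale1r; apply: supported_lin. Qed.

Lemma supportedZ (S : T -> bool) c u : supported S u -> supported S (c *: u).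
Proof.
move=> Su; rewrite -[_ *: _]addr0; apply: supported_lin => //.
exact: supported0.
Qed.

Lemma supported_sum (S : T -> bool) I (r : seq I) (P : pred I) F :
  (forall i, P i -> supported S (F i)) -> supported S (\sum_(i <- r | P i) F i).
Proof.
by move=> SF; apply: big_ind => //; [apply: supported0|apply: supportedD].
Qed.

Lemma supportedE (S : T -> bool) (r : seq T) u :
  uniq r -> (forall t, S t -> t \in r) -> supported S u ->
  u = \sum_(t <- r) coeff t u *: << t >>.
Proof.
move=> r_uniq Sr Su; apply/eqP/freeg_eqP => s.
rewrite (raddf_sum (coeff s)) /=.
have [sr|sr] := boolP (s \in r).
  rewrite (bigD1_seq s) //= big1 => [|t ts].
    by rewrite coeffZ coeffU eqxx !mulr1 addr0.
  by rewrite coeffZ coeffU (negPf ts) !mulr0.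
rewrite big_seq big1 => [|t tr].
  by apply/eqP; apply: contraNT sr => /Su/Sr.
have /negPf ts : t != s by apply: contraNneq sr => <-.
by rewrite coeffZ coeffU ts !mulr0.
Qed.

Lemma supported_bilinear_ext (S1 S2 S : T -> bool)
    (f : T -> T -> {freeg T / K}) u v :
  (forall a b, S1 a -> S2 b -> supported S (f a b)) ->
  supported S1 u -> supported S2 v -> supported S (bilinear_ext f u v).
Proof.
move=> Sf Su Sv; rewrite -(freeg_sumE u) -(freeg_sumE v).
rewrite (linear_map_sum _ _ _ (bilinear_extl f _)) big_seq.
apply: supported_sum => a; rewrite mem_dom => /Su Sa.
rewrite (freegUZ (coeff a u)) (linear_mapZ _ _ (bilinear_extl f _)).
apply: supportedZ.
rewrite (linear_map_sum _ _ _ (bilinear_extr f _)) big_seq.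
apply: supported_sum => b; rewrite mem_dom => /Sv Sb.
rewrite (freegUZ (coeff b v)) (linear_mapZ _ _ (bilinear_extr f _)).
apply: supportedZ.
by rewrite bilinear_extU; apply: Sf.
Qed.

Lemma freegU_free (r : seq T) (c : T -> K) :
  uniq r -> \sum_(t <- r) c t *: << t >> = 0 :> {freeg T / K} ->
  forall t, t \in r -> c t = 0.
Proof.
move=> r_uniq c0 s sr; have := congr1 (coeff s) c0.
rewrite coeff0 (raddf_sum (coeff s)) /= (bigD1_seq s) //= big1 => [|t ts].
  by rewrite coeffZ coeffU eqxx !mulr1 addr0.
by rewrite coeffZ coeffU (negPf ts) !mulr0.
Qed.
End FreeModule.

(** * The Dyck algebra of labelled trees *)

Inductive tree (m : nat) := Leaf | Node of 'I_m.+1 & tree m & tree m.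
Arguments Leaf {m}.

HB.instance Definition _ m := gen_eqMixin (tree m).
HB.instance Definition _ m := gen_choiceMixin (tree m).

Definition tree_space (K : fieldType) (m : nat) : Type := {freeg (tree m) / K}.
HB.instance Definition _ (K : fieldType) (m : nat) :=
  GRing.Lmodule.on (tree_space K m).

Section TreeAlgebra.
Context (K : fieldType) (m : nat).
Local Notation V := (tree_space K m).
Implicit Types (i j k l p : 'I_m.+1) (a b : tree m) (u v w : V).

Definition tvec a : V := << a >>.

(** Grafting two trees under a new node is not the product: the two agree when
    the right factor is a leaf or has a root label less than i, and differ in
    general. *)
Definition graft i : V -> V -> V := bilinear_ext (fun a b => tvec (Node i a b)).

(** The three cases are the two rewriting rules and the irreducible case. *)
Fixpoint tree_op i a b : V :=
  match b with
  | Leaf => tvec (Node i a Leaf)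
  | Node j b1 b2 =>
    if (i < j)%N then graft j (tree_op i a b1) (tvec b2)
    else if (j < i)%N then tvec (Node i a b)
    else \sum_(k < m.+1 | (i <= k)%N) graft i (tree_op k a b1) (tvec b2)
         - \sum_(l < m.+1 | (l < i)%N) graft i (tvec a) (tree_op l b1 b2)
  end.

Definition tree_mul i : V -> V -> V := bilinear_ext (tree_op i).

Lemma graftl i v : linear (graft i ^~ v). Proof. exact: bilinear_extl. Qed.
Lemma graftr i u : linear (graft i u). Proof. exact: bilinear_extr. Qed.
Lemma tree_mull i v : linear (tree_mul i ^~ v).
Proof. exact: bilinear_extl. Qed.
Lemma tree_mulr i u : linear (tree_mul i u). Proof. exact: bilinear_extr. Qed.
Lemma graftE i a b : graft i (tvec a) (tvec b) = tvec (Node i a b).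
Proof. exact: bilinear_extU. Qed.
Lemma tree_mulE i a b : tree_mul i (tvec a) (tvec b) = tree_op i a b.
Proof. exact: bilinear_extU. Qed.

Lemma tvec_linear_ext (W : lmodType K) (f g : V -> W) :
  linear f -> linear g -> (forall t, f (tvec t) = g (tvec t)) -> f =1 g.
Proof. exact: freeg_linear_ext. Qed.

Lemma tree_mul_leaf i u : tree_mul i u (tvec Leaf) = graft i u (tvec Leaf).
Proof.
apply: (tvec_linear_ext (tree_mull i _) (graftl i _)) => a.
by rewrite tree_mulE graftE.
Qed.

(** The defining rules of the product are trilinear identities, so it suffices
    to check them on trees; this discharges the linearity in each variable. *)
Ltac prove_linear := repeat first
  [ exact: graftr | exact: tree_mulr | exact: graftl | exact: tree_mull
  | match goal with |- GRing.linear_for _ (fun x => @?f x - @?g x) =>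
      apply: (@sub_linear K V V f g)
    end
  | apply: (comp_linear (graftr _ _)) | apply: (comp_linear (tree_mulr _ _))
  | apply: (comp_linear (graftl _ _)) | apply: (comp_linear (tree_mull _ _))
  | apply: sum_linear => ?].

Lemma tree_mul_graft_lt i j u v w : (i < j)%N ->
  tree_mul i u (graft j v w) = graft j (tree_mul i u v) w.
Proof.
move=> ij.
move: u; apply: tvec_linear_ext; [prove_linear|prove_linear|move=> a].
move: v; apply: tvec_linear_ext; [prove_linear|prove_linear|move=> b].
move: w; apply: tvec_linear_ext; [prove_linear|prove_linear|move=> c].
by rewrite graftE !tree_mulE /= ij.
Qed.

Lemma tree_mul_graft_gt i j u v w : (j < i)%N ->
  tree_mul i u (graft j v w) = graft i u (graft j v w).
Proof.
move=> ji.
move: u; apply: tvec_linear_ext; [prove_linear|prove_linear|move=> a].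
move: v; apply: tvec_linear_ext; [prove_linear|prove_linear|move=> b].
move: w; apply: tvec_linear_ext; [prove_linear|prove_linear|move=> c].
by rewrite graftE graftE !tree_mulE /= ltnNge ltnW //= ji.
Qed.

Lemma tree_mul_graft_eq i u v w :
  tree_mul i u (graft i v w)
  = \sum_(k < m.+1 | (i <= k)%N) graft i (tree_mul k u v) w
    - \sum_(l < m.+1 | (l < i)%N) graft i u (tree_mul l v w).
Proof.
move: u; apply: tvec_linear_ext; [prove_linear|prove_linear|move=> a].
move: v; apply: tvec_linear_ext; [prove_linear|prove_linear|move=> b].
move: w; apply: tvec_linear_ext; [prove_linear|prove_linear|move=> c].
rewrite graftE tree_mulE /= ltnn.
by congr (_ - _); apply: eq_bigr => k _; rewrite tree_mulE.
Qed.

(** A product by *_j of a tree with root label p is a combination of trees with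
    root label the maximum of j and p, so multiplying by a larger *_i on the
    left is just grafting. *)
Lemma tree_mul_mul_gt i j p u v w1 w2 : (j < i)%N -> (p < i)%N ->
  tree_mul i u (tree_mul j v (graft p w1 w2))
  = graft i u (tree_mul j v (graft p w1 w2)).
Proof.
move=> ji pi; have [jp|pj|/val_inj jp] := ltngtP j p.
- by rewrite tree_mul_graft_lt // tree_mul_graft_gt.
- by rewrite (tree_mul_graft_gt _ _ _ pj) tree_mul_graft_gt.
- rewrite jp tree_mul_graft_eq !(linear_mapB (tree_mulr i u)).
  rewrite (linear_mapB (graftr i u)).
  rewrite !(linear_map_sum _ _ _ (tree_mulr i u)).
  rewrite !(linear_map_sum _ _ _ (graftr i u)).
  by congr (_ - _); apply: eq_bigr => k _; rewrite tree_mul_graft_gt.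
Qed.

(** The two families of relations for a fixed right factor w and all u, v: the
    form in which they can be proved by induction on w. *)
Definition dyckA_at w := forall i j u v, (i < j)%N ->
  tree_mul i u (tree_mul j v w) = tree_mul j (tree_mul i u v) w.
Definition dyckS_at w := forall i u v,
  \sum_(j < m.+1 | (j <= i)%N) tree_mul i u (tree_mul j v w)
  = \sum_(k < m.+1 | (i <= k)%N) tree_mul i (tree_mul k u v) w.

Lemma dyck_at_leaf : dyckA_at (tvec Leaf) /\ dyckS_at (tvec Leaf).
Proof.
split=> [i j u v ij|i u v]; first by rewrite !tree_mul_leaf tree_mul_graft_lt.
rewrite sum_le_lt tree_mul_leaf tree_mul_graft_eq.
under [X in _ - X + _]eq_bigr do rewrite tree_mul_leaf.
under [X in _ + X]eq_bigr => j ji do rewrite tree_mul_leaf tree_mul_graft_gt //.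
by rewrite subrK; apply: eq_bigr => k _; rewrite tree_mul_leaf.
Qed.

Lemma dyckA_at_graft p w1 w2 : dyckA_at w1 -> dyckA_at (graft p w1 w2).
Proof.
move=> A1 i j u v ij; have [jp|pj|/val_inj <-] := ltngtP j p.
- by rewrite !tree_mul_graft_lt ?(ltn_trans ij) // A1.
- rewrite (tree_mul_graft_gt _ _ _ pj) tree_mul_graft_lt //.
  by rewrite (tree_mul_graft_gt _ _ _ pj).
rewrite !tree_mul_graft_eq (linear_mapB (tree_mulr i u)).
rewrite !(linear_map_sum _ _ _ (tree_mulr i u)).
congr (_ - _); apply: eq_bigr => k jk; rewrite tree_mul_graft_lt //.
by rewrite A1 // (leq_trans ij).
Qed.

(** For each k, the terms with j <= k are turned around by the second family of
    relations and the terms with j > k by the first; together they cover every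
    pair (k, l) with k, l >= i once. *)
Lemma sum_dyck_ge w i u v : dyckA_at w -> dyckS_at w ->
  \sum_(j < m.+1) \sum_(k < m.+1 | (i <= k)%N) tree_mul k u (tree_mul j v w)
  = \sum_(k < m.+1 | (i <= k)%N) \sum_(l < m.+1 | (i <= l)%N)
      tree_mul l (tree_mul k u v) w.
Proof.
move=> A S; rewrite exchange_big [RHS]exchange_big /=.
have E k : (i <= k)%N ->
    \sum_(j < m.+1) tree_mul k u (tree_mul j v w)
    = \sum_(l < m.+1 | (k <= l)%N) tree_mul k (tree_mul l u v) w
      + \sum_(j < m.+1 | (k < j)%N) tree_mul j (tree_mul k u v) w.
  move=> ik; rewrite -S (bigID (fun j : 'I_m.+1 => (j <= k)%N)) /=.
  congr (_ + _); apply: eq_big => [j|j]; first by rewrite -ltnNge.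
  by rewrite -ltnNge => kj; rewrite A.
rewrite (eq_bigr _ E) big_split /=.
rewrite [X in _ + X](exchange_big_dep (fun k : 'I_m.+1 => (i <= k)%N)) /=;
  last first.
  by move=> k j ik kj; rewrite ltnW // (leq_ltn_trans ik).
rewrite -big_split; apply: eq_bigr => k ik /=.
rewrite [RHS](bigID (fun l : 'I_m.+1 => (k <= l)%N)) /=; congr (_ + _).
  apply: eq_bigl => l; case: (leqP k l) => kl; rewrite ?andbF //.
  by rewrite (leq_trans ik).
by apply: eq_bigl => l; rewrite -ltnNge.
Qed.

(** The mirror image of the previous identity, below i: the second family
    accounts for the terms with j >= l, the first for those with j < l. *)
Lemma sum_dyck_lt w i u v : dyckA_at w -> dyckS_at w ->
  \sum_(j < m.+1) \sum_(l < m.+1 | (l < i)%N) tree_mul l (tree_mul j u v) w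
  = \sum_(l < m.+1 | (l < i)%N) \sum_(k < m.+1 | (k < i)%N)
      tree_mul k u (tree_mul l v w).
Proof.
move=> A S; rewrite exchange_big [RHS]exchange_big /=.
have E l : (l < i)%N ->
    \sum_(j < m.+1) tree_mul l (tree_mul j u v) w
    = \sum_(k < m.+1 | (k <= l)%N) tree_mul l u (tree_mul k v w)
      + \sum_(j < m.+1 | (j < l)%N) tree_mul j u (tree_mul l v w).
  move=> li; rewrite (sum_lt_ge l) -S addrC; congr (_ + _).
  by apply: eq_bigr => j jl; rewrite A.
rewrite (eq_bigr _ E) big_split /=.
rewrite [X in _ + X](exchange_big_dep (fun k : 'I_m.+1 => (k < i)%N)) /=;
  last first.
  by move=> k j ik kj; rewrite (ltn_trans kj).
rewrite -big_split; apply: eq_bigr => k ik /=.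
rewrite [RHS](bigID (fun l : 'I_m.+1 => (l <= k)%N)) /=; congr (_ + _).
  apply: eq_bigl => l; case: (leqP l k) => lk; rewrite ?andbF //.
  by rewrite (leq_ltn_trans lk).
by apply: eq_bigl => l; rewrite -ltnNge.
Qed.

(** When the label p equals i, expanding both sides leaves three kinds of terms.
    Those grafting onto w2 match by the identity above i at w1, those grafting
    onto u cancel by the identity below i at w2, and the mixed terms agree. *)
Lemma dyckS_at_graft p w1 w2 :
  (dyckA_at w1 /\ dyckS_at w1) -> (dyckA_at w2 /\ dyckS_at w2) ->
  dyckS_at (graft p w1 w2).
Proof.
move=> [A1 S1] [A2 S2] i u v; have [ip|pi|/val_inj ip] := ltngtP i p.
- under eq_bigr => j ji do
    rewrite tree_mul_graft_lt ?(leq_ltn_trans ji) // tree_mul_graft_lt //.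
  rewrite -(linear_map_sum _ _ _ (graftl p w2)) S1.
  rewrite (linear_map_sum _ _ _ (graftl p w2)).
  by apply: eq_bigr => k _; rewrite tree_mul_graft_lt.
- rewrite sum_le_lt (tree_mul_graft_gt _ _ _ pi) tree_mul_graft_eq.
  under [X in _ + X]eq_bigr => j ji do rewrite tree_mul_mul_gt //.
  by rewrite subrK; apply: eq_bigr => k _; rewrite (tree_mul_graft_gt _ _ _ pi).
rewrite -{p}ip.
pose G j := \sum_(k < m.+1 | (i <= k)%N)
    graft i (tree_mul k u (tree_mul j v w1)) w2
  - \sum_(l < m.+1 | (l < i)%N) graft i u (tree_mul l (tree_mul j v w1) w2).
have lower j : (j < i)%N -> tree_mul i u (tree_mul j v (graft i w1 w2)) = G j.
  by move=> ji; rewrite tree_mul_graft_lt // tree_mul_graft_eq.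
have equal : tree_mul i u (tree_mul i v (graft i w1 w2))
    = \sum_(j < m.+1 | (i <= j)%N) G j
      - \sum_(l < m.+1 | (l < i)%N)
        (\sum_(k < m.+1 | (i <= k)%N)
           graft i (tree_mul k u v) (tree_mul l w1 w2)
         - \sum_(k < m.+1 | (k < i)%N)
             graft i u (tree_mul k v (tree_mul l w1 w2))).
  rewrite tree_mul_graft_eq (linear_mapB (tree_mulr i u)).
  rewrite !(linear_map_sum _ _ _ (tree_mulr i u)).
  by congr (_ - _); apply: eq_bigr => k _; rewrite tree_mul_graft_eq.
rewrite sum_le_lt (eq_bigr _ lower) equal addrC addrA -sum_lt_ge.
under [RHS]eq_bigr => k _ do rewrite tree_mul_graft_eq.
rewrite /G !sumrB.
have -> : \sum_(j < m.+1) \sum_(k < m.+1 | (i <= k)%N)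
      graft i (tree_mul k u (tree_mul j v w1)) w2
    = \sum_(k < m.+1 | (i <= k)%N) \sum_(l < m.+1 | (i <= l)%N)
      graft i (tree_mul l (tree_mul k u v) w1) w2.
  have := congr1 (graft i ^~ w2) (sum_dyck_ge i u v A1 S1).
  rewrite !(linear_map_sum _ _ _ (graftl i w2)).
  under eq_bigr do rewrite (linear_map_sum _ _ _ (graftl i w2)).
  by under [RHS]eq_bigr do rewrite (linear_map_sum _ _ _ (graftl i w2)).
have -> : \sum_(j < m.+1) \sum_(l < m.+1 | (l < i)%N)
      graft i u (tree_mul l (tree_mul j v w1) w2)
    = \sum_(l < m.+1 | (l < i)%N) \sum_(k < m.+1 | (k < i)%N)
      graft i u (tree_mul k v (tree_mul l w1 w2)).
  have := congr1 (graft i u) (sum_dyck_lt i v w1 A2 S2).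
  rewrite !(linear_map_sum _ _ _ (graftr i u)).
  under eq_bigr do rewrite (linear_map_sum _ _ _ (graftr i u)).
  by under [RHS]eq_bigr do rewrite (linear_map_sum _ _ _ (graftr i u)).
rewrite opprB addrA subrK; congr (_ - _).
exact: exchange_big.
Qed.

Lemma dyck_at_tree a : dyckA_at (tvec a) /\ dyckS_at (tvec a).
Proof.
elim: a => [|p a1 IH1 a2 IH2]; first exact: dyck_at_leaf.
rewrite -graftE; split; first by apply: dyckA_at_graft; case: IH1.
exact: dyckS_at_graft.
Qed.

Lemma tree_mulA i j u v w : (i < j)%N ->
  tree_mul i u (tree_mul j v w) = tree_mul j (tree_mul i u v) w.
Proof.
move=> ij; move: w.
apply: tvec_linear_ext; [prove_linear|prove_linear|move=> c].
by case: (dyck_at_tree c) => A _; apply: A.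
Qed.

Lemma tree_mul_sum i u v w :
  \sum_(j < m.+1 | (j <= i)%N) tree_mul i u (tree_mul j v w)
  = \sum_(k < m.+1 | (i <= k)%N) tree_mul i (tree_mul k u v) w.
Proof.
move: w; apply: tvec_linear_ext; [prove_linear|prove_linear|move=> c].
by case: (dyck_at_tree c) => _; apply.
Qed.

End TreeAlgebra.

HB.instance Definition _ (K : fieldType) (m : nat) :=
  isDyckAlgebra.Build K m (tree_space K m) (@tree_mull K m) (@tree_mulr K m)
    (@tree_mulA K m) (@tree_mul_sum K m).

(** * Enumeration and count of the normal trees *)

Section NormalTrees.
Context (m : nat).
Implicit Types (i j : 'I_m.+1) (a b t : tree m).

Fixpoint leaves t : nat :=
  if t is Node _ a b then (leaves a + leaves b)%N else 1.

(** One more than the root label, so that a single leaf, which may occur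
    anywhere, gets the bound 0. *)
Definition root_bound t : nat := if t is Node i _ _ then i.+1 else 0.

Fixpoint normal t : bool :=
  if t is Node i a b then [&& normal a, normal b & (root_bound b <= i)%N]
  else true.

Definition normal_sized n q t :=
  [&& normal t, leaves t == n & (root_bound t <= q)%N].

Lemma leaves_gt0 t : (0 < leaves t)%N.
Proof. by elim: t => //= i a IHa b _; rewrite addn_gt0 IHa. Qed.

Lemma root_bound_le t : (root_bound t <= m.+1)%N.
Proof. by case: t => //= i a b; apply: ltn_ord. Qed.

(** Lists the normal trees with n leaves and root label less than q.  The
    recursion on q enumerates the right subtrees, whose labels are smaller; the
    left subtrees have arbitrary labels but fewer leaves, and f bounds n. *)
Fixpoint normal_trees (f : nat) : nat -> nat -> seq (tree m) :=
  if f is f'.+1 then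
    fix below (n q : nat) {struct q} : seq (tree m) :=
      if q is q'.+1 then
        below n q' ++
        [seq Node (inord q') a b
           | a <- flatten [seq normal_trees f' k m.+1 | k <- iota 1 n.-1],
             b <- below (n - leaves a)%N q']
      else if n == 1%N then [:: Leaf] else [::]
  else fun _ _ => [::].

Lemma normal_treesS f n q :
  normal_trees f.+1 n q.+1 = normal_trees f.+1 n q ++
    [seq Node (inord q) a b
       | a <- flatten [seq normal_trees f k m.+1 | k <- iota 1 n.-1],
         b <- normal_trees f.+1 (n - leaves a)%N q].
Proof. by []. Qed.

Lemma mem_normal_trees f n q t : (n <= f)%N -> (0 < n)%N -> (q <= m.+1)%N ->
  (t \in normal_trees f n q) = normal_sized n q t.
Proof.
elim: f n q t => [|f IHf] n q t; first by case: n.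
elim: q n t => [|q IHq] n t nf n0 qm.
  rewrite /= /normal_sized; have [->|n1] := eqVneq n 1%N.
    rewrite mem_seq1; case: t => [|i a b]; first by rewrite eqxx.
    by rewrite /= ltn0 !andbF; apply/eqP.
  rewrite in_nil; case: t => [|i a b]; first by rewrite /= eq_sym (negPf n1).
  by rewrite /= ltn0 !andbF.
rewrite normal_treesS mem_cat IHq ?(ltnW qm) //.
have memF a : (a \in flatten [seq normal_trees f k m.+1 | k <- iota 1 n.-1])
    = normal a && (leaves a < n)%N.
  apply/flattenP/andP => [[s /mapP[k]]|[Na an]].
    rewrite mem_iota => /andP[k0 kn] ->.
    rewrite IHf //; last by lia.
    by case/and3P=> Na /eqP -> _; split=> //; lia.
  exists (normal_trees f (leaves a) m.+1).
    by apply: map_f; rewrite mem_iota leaves_gt0; lia.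
  rewrite IHf ?leaves_gt0 //; last by lia.
  by rewrite /normal_sized Na eqxx root_bound_le.
apply/orP/idP => [[|]|].
- case/and3P=> Nt et ht; rewrite /normal_sized Nt et /=; exact: leqW.
- case/allpairsPdep=> a [b [+ + ->]]; rewrite memF => /andP[Na an].
  rewrite IHq ?subn_gt0 //; [|by lia|by lia].
  case/and3P=> Nb /eqP eb hb.
  rewrite /normal_sized /= Na Nb inordK // hb eb subnKC ?(ltnW an) //.
  by rewrite eqxx ltnS leqnn.
case/and3P=> Nt et; rewrite leq_eqVlt => /orP[|ht]; last first.
  by left; rewrite /normal_sized Nt et.
case: t Nt et => // i a b /= /and3P[Na Nb hb] /eqP en /eqP[iq]; right.
apply/allpairsPdep; exists a, b; split.
- by rewrite memF Na /= -en -[X in (X < _)%N]addn0 ltn_add2l leaves_gt0.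
- have b0 := leaves_gt0 b; have a0 := leaves_gt0 a.
  rewrite IHq; [|lia|lia|lia].
  by rewrite /normal_sized Nb -iq hb -en addKn eqxx.
- by congr Node; apply: val_inj; rewrite /= inordK -?iq.
Qed.

Lemma uniq_flatten_by (T : eqType) (g : T -> nat) (F : nat -> seq T)
    (r : seq nat) :
  uniq r -> (forall k, k \in r -> uniq (F k)) ->
  (forall k x, k \in r -> x \in F k -> g x = k) ->
  uniq (flatten [seq F k | k <- r]).
Proof.
elim: r => //= k r IH /andP[kr r_uniq] Fu Fg; rewrite cat_uniq Fu ?mem_head //=.
rewrite IH //; first last.
- by move=> l x lr; apply: Fg; rewrite inE lr orbT.
- by move=> l lr; apply: Fu; rewrite inE lr orbT.
rewrite andbT; apply/hasPn => x /flattenP[_ /mapP[l lr ->]] xl.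
apply: contra kr => xk.
by rewrite -(Fg _ _ (mem_head _ _) xk) (Fg l) // inE lr orbT.
Qed.

Lemma normal_trees_uniq f n q : (n <= f)%N -> (0 < n)%N -> (q <= m.+1)%N ->
  uniq (normal_trees f n q).
Proof.
elim: f n q => [|f IHf] n q; first by case: n.
elim: q n => [|q IHq] n nf n0 qm; first by rewrite /=; case: eqP.
rewrite normal_treesS cat_uniq IHq ?(ltnW qm) // andTb; apply/andP; split.
  apply/hasPn => _ /allpairsPdep[a [b [_ _ ->]]].
  rewrite mem_normal_trees ?(ltnW qm) // /normal_sized /= inordK // ltnn.
  by rewrite !andbF.
have memF a : a \in flatten [seq normal_trees f k m.+1 | k <- iota 1 n.-1] ->
    (leaves a < n)%N.
  case/flattenP=> s /mapP[k]; rewrite mem_iota => /andP[k0 kn] ->.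
  rewrite mem_normal_trees //; last by lia.
  by case/and3P=> _ /eqP -> _; lia.
apply: allpairs_uniq_dep.
- apply: (uniq_flatten_by (g := leaves)); first exact: iota_uniq.
    by move=> k; rewrite mem_iota => /andP[k0 kn]; apply: IHf; lia.
  move=> k t; rewrite mem_iota => /andP[k0 kn].
  by rewrite mem_normal_trees //; [case/and3P=> _ /eqP|lia].
- move=> a /memF an; apply: IHq; lia.
- by move=> [a b] [a' b'] _ _ /= [-> ->].
Qed.

(** The coefficient of t^n in B^r, where B = 1 + t B^p: multiplying this
    equation by B^r gives B^(r+1) = B^r + t B^(r+p), which is the recursion. *)
Fixpoint raney (p n : nat) : nat -> nat :=
  if n is n'.+1 then
    fix go r := if r is r'.+1 then (go r' + raney p n' (r' + p))%N else 0%N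
  else fun _ => 1%N.

Lemma raneyS p n r : raney p n.+1 r.+1 = (raney p n.+1 r + raney p n (r + p))%N.
Proof. by []. Qed.

(** This is B^r B^s = B^(r+s), coefficientwise. *)
Lemma raney_conv p n r s :
  (\sum_(k < n.+1) raney p k r * raney p (n - k) s)%N = raney p n (r + s).
Proof.
elim: n r s => [|n IHn] r s; first by rewrite big_ord1.
elim: r => [|r IHr].
  by rewrite big_ord_recl big1 /= ?mul1n ?addn0.
rewrite addSn raneyS -IHr addnAC -IHn big_ord_recl [in RHS]big_ord_recl /=.
rewrite -addnA; congr (_ + _)%N; rewrite -big_split /=; apply: eq_bigr => k _.
by rewrite /bump /= add1n subSS mulnDl.
Qed.

Lemma raney_closed p n r : (0 < p)%N ->
  ((p * n + r) * raney p n r = r * 'C(p * n + r, n))%N.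
Proof.
move=> p0; elim: n r => [|n IHn] r; first by rewrite muln0 bin0.
elim: r => [|r IHr]; first by rewrite muln0.
have {}IHn := IHn (r + p)%N.
set N := (p * n.+1 + r)%N in IHr.
have NE : (p * n + (r + p) = N)%N by rewrite /N; lia.
rewrite NE in IHn; rewrite raneyS addnS -/N.
set A := raney p n.+1 r in IHr *; set B := raney p n (r + p) in IHn *.
have N0 : (0 < N)%N by rewrite /N; lia.
(* N is the denominator of both closed forms supplied by the induction, so the
   identity is proved after multiplying it by N. *)
apply/eqP; rewrite -(eqn_pmul2l N0); apply/eqP.
have e1 := binS N n.
have e2 : (N.+1 * 'C(N, n) = n.+1 * 'C(N.+1, n.+1))%N.
  exact: mul_bin_diag N.+1 n.
rewrite e1 in e2 *.
set X := 'C(N, n.+1) in e2 IHr *; set Y := 'C(N, n) in e2 IHn *.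
have -> : (N * (N.+1 * (A + B)) = N.+1 * (N * A + N * B))%N by ring.
rewrite IHr IHn.
have -> : (N.+1 * (r * X + (r + p) * Y)
  = N.+1 * r * (X + Y) + p * (N.+1 * Y))%N by ring.
rewrite e2.
have -> : (p * (n.+1 * (X + Y)) = (p * n.+1) * (X + Y))%N by ring.
rewrite -mulnDl mulnA; congr (_ * _)%N; rewrite /N; ring.
Qed.

(** In terms of T = B - 1 the trees counted have generating series t B^q, whence
    the shift of n by one; the sum over left and right subtrees is a convolution
    of Raney numbers. *)
Lemma size_normal_trees f n q : (n <= f)%N -> (0 < n)%N -> (q <= m.+1)%N ->
  size (normal_trees f n q) = raney m.+1 n.-1 q.
Proof.
elim: f n q => [|f IHf] n q; first by case: n.
elim: q n => [|q IHq] n nf n0 qm; first by case: n nf n0 => [|[|n]].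
rewrite normal_treesS size_cat IHq ?(ltnW qm) //.
rewrite size_allpairs_dep sumnE big_map.
rewrite big_flatten big_map /=.
rewrite (eq_big_seq
  (fun k => raney m.+1 k.-1 m.+1 * raney m.+1 (n - k).-1 q)%N).
  case: n nf n0 => [//|[|n]] nf _; first by rewrite /= big_nil.
  rewrite -![n.+2.-1]/n.+1 raneyS [(q + _)%N in RHS]addnC -raney_conv.
  congr (_ + _)%N; rewrite (iotaDl 1 0) big_map -/(index_iota 0 n.+1) big_mkord.
  by apply: eq_bigr => k _; congr (_ * raney _ _ _)%N; lia.
move=> k; rewrite mem_iota => /andP[k0 kn].
rewrite -(IHf k) //; last by lia.
rewrite (eq_big_seq (fun=> raney m.+1 (n - k).-1 q)); last first.
  move=> a; rewrite mem_normal_trees //; last by lia.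
  by case/and3P=> _ /eqP -> _; apply: IHq; lia.
by rewrite big_const_seq count_predT iter_addn_0 mulnC.
Qed.

Lemma size_normal_trees_dyck n : (0 < n)%N ->
  (size (normal_trees n n m.+1))%:R = dyck_number m n.
Proof.
case: n => // n _; rewrite size_normal_trees //= /dyck_number.
have := raney_closed n m.+1 (ltn0Sn m); rewrite -mulnSr -mulnA => /eqP.
rewrite eqn_pmul2l // => /eqP E.
have := mul_bin_left (m.+1 * n.+1) n; rewrite -E mulnCA => /eqP.
rewrite eqn_pmul2l // => /eqP ->.
have -> : (m.+1 * n.+1 - n = (m * n.+1).+1)%N by lia.
by rewrite natrM [X in X / _]mulrC mulfK // Num.Theory.pnatr_eq0.
Qed.

End NormalTrees.

(** * Products of normal trees *)

Section NormalSpan.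
Context (K : fieldType) (m : nat).
Local Notation V := (tree_space K m).
Implicit Types (i j : 'I_m.+1) (a b t : tree m) (u v w : V).

Lemma supported_graft (S1 S2 S : tree m -> bool) i u v :
  (forall a b, S1 a -> S2 b -> S (Node i a b)) ->
  supported S1 u -> supported S2 v -> supported S (graft i u v).
Proof.
move=> Sn; apply: supported_bilinear_ext => a b Sa Sb.
exact/supportedU/Sn.
Qed.

(** The root label of every term of the product is the maximum of i and the root
    label of b, so a common bound q survives.  This is why, for equal labels,
    grafting onto the product of b1 and b2 again gives normal trees. *)
Lemma supported_tree_op i a b (n1 n2 q : nat) :
  (i < q)%N -> normal_sized n1 m.+1 a -> normal_sized n2 q b ->
  supported (normal_sized (n1 + n2)%N q) (tree_op K i a b).
Proof.
elim: b i a n1 n2 q => [|j b1 IH1 b2 IH2] i a n1 n2 q iq.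
  case/and3P=> Na /eqP <- _ /and3P[_ /eqP <- _].
  by apply: supportedU; rewrite /normal_sized /= Na eqxx.
case/and3P=> Na /eqP <- _ /and3P[/= /and3P[N1 N2 h2] /eqP <- jq].
have Sa : supported (normal_sized (leaves a) m.+1) (tvec K a).
  by apply: supportedU; rewrite /normal_sized Na eqxx root_bound_le.
have S2 : supported (normal_sized (leaves b2) j) (tvec K b2).
  by apply: supportedU; rewrite /normal_sized N2 eqxx.
have left k : supported (normal_sized (leaves a + (leaves b1 + leaves b2))%N q)
    (graft j (tree_op K k a b1) (tvec K b2)).
  apply: (supported_graft _ (IH1 k a (leaves a) (leaves b1) m.+1 _ _ _) S2).
  - move=> s t /and3P[Ns /eqP es _] /and3P[Nt /eqP et ht].
    by rewrite /normal_sized /= Ns Nt ht es et addnA eqxx.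
  - exact: ltn_ord.
  - by rewrite /normal_sized Na eqxx root_bound_le.
  - by rewrite /normal_sized N1 eqxx root_bound_le.
have [_|ji] := ltnP i j; first exact: left.
case: (ltngtP j i) ji => // [ji _|/val_inj ji _].
  by apply: supportedU; rewrite /normal_sized /= Na N1 N2 h2 eqxx ji.
rewrite -[X in supported _ X]addrC -scaleN1r; apply: supported_lin.
  apply: supported_sum => l li.
  apply: (supported_graft _ Sa
    (IH2 l b1 (leaves b1) (leaves b2) i _ _ _)) => //.
  - move=> s t /and3P[Ns /eqP es _] /and3P[Nt /eqP et ht].
    by rewrite /normal_sized /= Ns Nt ht es et eqxx.
  - by rewrite /normal_sized N1 eqxx root_bound_le.
  - by rewrite /normal_sized N2 eqxx -ji.
by apply: supported_sum => k _; rewrite -ji; apply: left.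
Qed.

Lemma supported_tree_mul i u v (n1 n2 : nat) :
  supported (normal_sized n1 m.+1) u -> supported (normal_sized n2 m.+1) v ->
  supported (normal_sized (n1 + n2)%N m.+1) (tree_mul i u v).
Proof.
apply: supported_bilinear_ext => a b Na Nb.
exact: supported_tree_op (ltn_ord i) _ _.
Qed.

Lemma tree_op_normal i a b : (root_bound b <= i)%N ->
  tree_op K i a b = tvec K (Node i a b).
Proof. by case: b => //= j b1 b2 ji; rewrite ltnNge ltnW //= ji. Qed.

End NormalSpan.

(** * Evaluation of trees in a Dyck algebra *)

Section Evaluation.
Context (K : fieldType) (m : nat) (D : dyckAlgType K m) (x : D).
Local Notation V := (tree_space K m).
Implicit Types (i j : 'I_m.+1) (a b t : tree m) (u v w : V).

Fixpoint tree_eval t : D :=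
  if t is Node i a b then dyck_op i (tree_eval a) (tree_eval b) else x.

Definition eval : V -> D := fglift tree_eval.

Lemma eval_linear : linear eval. Proof. exact: fglift_linear. Qed.

Lemma evalE t : eval (tvec K t) = tree_eval t. Proof. exact: fgliftU1. Qed.

Lemma eval_graft i u v : eval (graft i u v) = dyck_op i (eval u) (eval v).
Proof.
move: u; apply: tvec_linear_ext.
- exact: comp_linear eval_linear (graftl i v).
- exact: comp_linear (dyck_op_linearl i _) eval_linear.
move=> a; move: v; apply: tvec_linear_ext.
- exact: comp_linear eval_linear (graftr i _).
- exact: comp_linear (dyck_op_linearr i _) eval_linear.
by move=> b; rewrite graftE !evalE.
Qed.

Lemma dyck_op_sum_eq i (y z w : D) :
  \sum_(k < m.+1 | (i <= k)%N) dyck_op i (dyck_op k y z) w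
  - \sum_(l < m.+1 | (l < i)%N) dyck_op i y (dyck_op l z w)
  = dyck_op i y (dyck_op i z w).
Proof.
by rewrite -dyck_op_sum sum_le_lt addrK.
Qed.

Lemma eval_tree_op i a b :
  eval (tree_op K i a b) = dyck_op i (tree_eval a) (tree_eval b).
Proof.
elim: b i a => [|j b1 IH1 b2 IH2] i a; first by rewrite evalE.
rewrite /=; have [ij|ji] := ltnP i j.
  by rewrite eval_graft IH1 evalE dyck_opA.
case: (ltngtP j i) ji => // [ji _|/val_inj ji _]; first by rewrite evalE.
rewrite (linear_mapB eval_linear) !(linear_map_sum _ _ _ eval_linear).
rewrite ji -dyck_op_sum_eq; congr (_ - _); apply: eq_bigr => k _.
  by rewrite eval_graft IH1 evalE.
by rewrite eval_graft IH2 evalE.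
Qed.

Lemma eval_tree_mul i u v : eval (tree_mul i u v) = dyck_op i (eval u) (eval v).
Proof.
move: u; apply: tvec_linear_ext.
- exact: comp_linear eval_linear (tree_mull i v).
- exact: comp_linear (dyck_op_linearl i _) eval_linear.
move=> a; move: v; apply: tvec_linear_ext.
- exact: comp_linear eval_linear (tree_mulr i _).
- exact: comp_linear (dyck_op_linearr i _) eval_linear.
by move=> b; rewrite tree_mulE eval_tree_op !evalE.
Qed.

(** Homogeneous elements are values of combinations of normal trees, since both
    are closed under products and linear combinations. *)
Lemma homogeneous_eval n (y : D) : homogeneous x n y ->
  exists2 v : V, supported (normal_sized n m.+1) v & eval v = y.
Proof.
elim=> {n y} [|a b i _ _ _ [u Nu <-] _ [v Nv <-]|n|
  n c _ _ _ [u Nu <-] _ [v Nv <-]].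
- by exists (tvec K Leaf); rewrite ?evalE //; apply: supportedU.
- exists (tree_mul i u v); last exact: eval_tree_mul.
  exact: supported_tree_mul.
- exists 0; first exact: supported0.
  exact: linear_map0 eval_linear.
- exists (c *: u + v); last exact: eval_linear.
  exact: supported_lin.
Qed.

Lemma tree_eval_homogeneous t : homogeneous x (leaves t) (tree_eval t).
Proof.
by elim: t => [|i a Ha b Hb] /=; [apply: homogeneous_gen|apply: homogeneous_op].
Qed.

(** A normal tree is the product in the tree algebra of its two subtrees, hence
    a morphism to that algebra undoes evaluation on normal trees. *)
Lemma tree_eval_section (f : D -> V) : dyck_morphism f -> f x = tvec K Leaf ->
  forall t, normal t -> f (tree_eval t) = tvec K t.
Proof.
move=> [_ fop] fx; elim=> [|i a IHa b IHb] //= /and3P[Na Nb hb].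
by rewrite fop IHa // IHb // -tree_op_normal // -tree_mulE.
Qed.

End Evaluation.

Theorem corollary1p3p5 (K : fieldType) (m n : nat) (hm : (1 <= m)%N)
    (hn : (1 <= n)%N) (D : dyckAlgType K m) (x : D)
    (xfree : is_free_dyck x) :
  exists d : nat,
    has_dim (homogeneous x n) d /\ (d%:R : rat) = dyck_number m n.
Proof.
pose r := normal_trees m n n m.+1.
have memr t : (t \in r) = normal_sized n m.+1 t by apply: mem_normal_trees.
have r_uniq : uniq r by apply: normal_trees_uniq.
exists (size r); split; last exact: size_normal_trees_dyck.
pose b k := tnth (in_tuple r) k.
exists (fun k => tree_eval x (b k)); split.
  move=> c c0 k.
  have [f [[fl fop] fx _]] := xfree (tree_space K m) (tvec K Leaf).
  (* The coefficients reindexed by the trees; the default 0 is never read. *)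
  pose g t := if insub (index t r) is Some k then c k else 0.
  have gE k' : g (b k') = c k'.
    rewrite /g /b (tnth_nth Leaf) index_uniq //.
    by rewrite valK.
  rewrite -gE; apply: (freegU_free r_uniq (c := g)); last exact: mem_tnth.
  rewrite big_tnth -[RHS](linear_map0 fl) -c0 (linear_map_sum _ _ _ fl).
  apply: eq_bigr => k' _; rewrite -/(b k') gE (linear_mapZ _ _ fl).
  congr (_ *: _).
  rewrite (tree_eval_section (conj fl fop) fx) //.
  by have := mem_tnth k' (in_tuple r); rewrite memr => /and3P[].
move=> v; split=> [/homogeneous_eval[w Nw <-]|[c ->]].
  have wE := supportedE r_uniq (fun t => etrans (memr t)) Nw.
  exists (fun k => coeff (b k) w); rewrite [in LHS]wE.
  rewrite (linear_map_sum _ _ _ (eval_linear x)) big_tnth.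
  apply: eq_bigr => k _; rewrite (linear_mapZ _ _ (eval_linear x)).
  by congr (_ *: _); apply: evalE.
apply: homogeneous_sum => k _; rewrite -[_ *: _]addr0.
apply: homogeneous_lin; last exact: homogeneous_0.
have := mem_tnth k (in_tuple r); rewrite memr => /and3P[_ /eqP <- _].
exact: tree_eval_homogeneous.
Qed.
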